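(* Let $P_0,P_1,P_2$ be noncollinear points in $\mathbb{P}^N$, let $m_0,m_1,m_2$ be non-negative integers with $\max(m_0,m_1)\le m_2$, and consider the fat point scheme $Z=m_0P_0+m_1P_1+m_2P_2$. If $m_0+m_1>m_2$ and $m_0+m_1+m_2$ is odd, then $$\rho(I(Z))=\frac{m_0+m_1+m_2+1}{m_0+m_1+m_2}.$$
   Context: $\mathbb{K}$ is an algebraically closed field of any characteristic, $N\ge 2$, and $R=\mathbb{K}[x_0,\ldots,x_N]$ is the homogeneous coordinate ring of $\mathbb{P}^N$. For a point $P$, $I(P)\subseteq R$ is the ideal generated by all forms vanishing at $P$. For distinct points $P_i$ and non-negative integers $m_i$, the fat point scheme $Z=\sum_i m_iP_i$ has ideal $I(Z)=\bigcap_i I(P_i)^{m_i}$ (with $I(P)^0=R$). The $m$-th symbolic power of $I(Z)$ is $I(Z)^{(m)}=\bigcap_i I(P_i)^{mm_i}$. For a non-zero proper homogeneous ideal $I$ of this type, the resurgence is $\rho(I)=\sup\{m/r : I^{(m)}\not\subseteq I^r\}$, with $m,r$ ranging over positive integers. *)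

(* Defs.v *)
From mathcomp Require Import all_boot all_order all_algebra.
From mathcomp Require Import classical_sets reals.
From mathcomp Require Import mpoly.

Set Implicit Arguments.
Unset Strict Implicit.
Unset Printing Implicit Defensive.

Import Order.TTheory GRing.Theory Num.Theory.

Local Open Scope classical_set_scope.
Local Open Scope ring_scope.

Definition ideal_gen (A : comNzRingType) (S : set A) : set A :=
  [set f | exists (k : nat) (c g : 'I_k -> A),
     (forall i, S (g i)) /\ f = \sum_(i < k) c i * g i].

Definition ideal_mul (A : comNzRingType) (I J : set A) : set A :=
  ideal_gen [set h | exists f g, [/\ I f, J g & h = f * g]].

(* I^0 is the unit ideal. *)
Definition ideal_exp (A : comNzRingType) (I : set A) (r : nat) : set A :=
  iter r (ideal_mul I) setT.

(* A point of P^N is given by a vector of homogeneous coordinates, so two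
   proportional vectors represent the same point.  Nothing below depends on
   the choice of representative. *)
Definition ppoint (K : fieldType) (N : nat) : Type :=
  {v : 'rV[K]_N.+1 | v != 0}.

(* A line of P^N is a 2-dimensional linear subspace of K^(N+1). *)
Definition collinear (K : fieldType) (N : nat) (P Q S : ppoint K N) : Prop :=
  exists L : {vspace 'rV[K]_N.+1},
    [/\ \dim L = 2%N, val P \in L, val Q \in L & val S \in L].

Definition point_ideal (K : fieldType) (N : nat) (P : ppoint K N) :
    set {mpoly K[N.+1]} :=
  ideal_gen [set f | (exists d : nat, f \is d.-homog) /\ f.@[val P 0] = 0].

(* The list of the (P_i, m_i) in the formal sum of the m_i P_i; the P_i are
   meant to be distinct as points of P^N. *)
Definition fat_points (K : fieldType) (N : nat) : Type := seq (ppoint K N * nat).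

Definition fat_ideal (K : fieldType) (N : nat) (Z : fat_points K N) :
    set {mpoly K[N.+1]} :=
  [set f | forall pm, pm \in Z -> ideal_exp (point_ideal pm.1) pm.2 f].

Definition symbolic_power (K : fieldType) (N : nat) (Z : fat_points K N)
    (m : nat) : set {mpoly K[N.+1]} :=
  [set f | forall pm, pm \in Z -> ideal_exp (point_ideal pm.1) (m * pm.2) f].

(* [sup] is 0 on a set that is empty or unbounded above, so [resurgence R Z = x]
   with x <> 0 does assert that the supremum exists and equals x. *)
Definition resurgence (R : realType) (K : fieldType) (N : nat)
    (Z : fat_points K N) : R :=
  sup [set q : R | exists m r : nat,
    [/\ (0 < m)%N, (0 < r)%N,
        ~ (symbolic_power Z m `<=` ideal_exp (fat_ideal Z) r)
      & q = m%:R / r%:R]].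

(* Main.v *)
Require Import Defs.
From mathcomp Require Import all_boot all_order all_algebra.
From mathcomp Require Import classical_sets reals.
From mathcomp Require Import mpoly zify lra.

(* In linear coordinates where P0, P1, P2 are coordinate points, every ideal in
   sight is monomial, so containment is a question about exponent vectors.  For
   an exponent m let D be its degree, a_i its entry at P_i and w the degree in
   the variables vanishing at all three points; then x^m lies in I^(k) iff
   k m_i + a_i <= D for i = 0, 1, 2.  Put s = m_0 + m_1 + m_2 = 2 sg - 1.
   Adding the three inequalities for k = 1 and rounding gives sg <= D + w on I,
   so r sg <= D + w on I^r.  Conversely, an exponent with r m_i + a_i <= D and
   r sg <= D + w is a sum of r exponents of I: one can always split off a part
   of degree floor(D / r).  Hence I^(k) is contained in I^r as soon as
   k s >= r (s + 1), while x_0^(t(s - 2 m_0)) x_1^(t(s - 2 m_1)) x_2^(t(s - 2 m_2)),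
   of degree t s, is in I^(2t) but not in I^r when 2 t s < r (s + 1). *)

Set Implicit Arguments.
Unset Strict Implicit.
Unset Printing Implicit Defensive.
Import Order.TTheory GRing.Theory Num.Theory.

(** * Arithmetic of exponents: splitting off one summand *)

Lemma box_sum2 (l0 l1 h0 h1 d : nat) :
  l0 <= h0 -> l1 <= h1 -> l0 + l1 <= d <= h0 + h1 ->
  exists x0 x1, [/\ l0 <= x0 <= h0, l1 <= x1 <= h1 & x0 + x1 = d].
Proof.
by move=> *; exists (minn h0 (d - l1)), (d - minn h0 (d - l1)); split; lia.
Qed.

Lemma box_sum4 (l0 l1 l2 l3 h0 h1 h2 h3 d : nat) :
  l0 <= h0 -> l1 <= h1 -> l2 <= h2 -> l3 <= h3 ->
  l0 + l1 + l2 + l3 <= d <= h0 + h1 + h2 + h3 ->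
  exists x0 x1 x2 x3, [/\ l0 <= x0 <= h0, l1 <= x1 <= h1, l2 <= x2 <= h2,
    l3 <= x3 <= h3 & x0 + x1 + x2 + x3 = d].
Proof.
move=> lh0 lh1 lh2 lh3 ld.
have [|||x [y [hx hy xy]]] := @box_sum2 (l0 + l1) (l2 + l3) (h0 + h1) (h2 + h3) d.
- exact: leq_add.
- exact: leq_add.
- by lia.
have [x0 [x1 [hx0 hx1 x01]]] := box_sum2 lh0 lh1 hx.
have [x2 [x3 [hx2 hx3 x23]]] := box_sum2 lh2 lh3 hy.
by exists x0, x1, x2, x3; split=> //; lia.
Qed.

(** Strictness gains a full [r] by integrality. Recording each comparison with its multiple lets the
    products with [r] later be treated as independent unknowns. *)
Lemma leq_mul_cases (r x y : nat) :
  x <= y /\ r * x <= r * y \/ y < x /\ r * y + r <= r * x.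
Proof.
by case: (leqP x y) => h; [left | right]; split=> //;
  by rewrite ?leq_mul2l ?h ?orbT // addnC -mulnS leq_mul2l h orbT.
Qed.

(** The part split off has degree d = floor(D / (r+1)), so that [a_i + r.+1 * m_i <= D] forces
    [m_i <= d]. The conditions on both parts then confine each entry to an interval, and it remains
    to see that the endpoint sums enclose d. *)
Lemma weight_peel (m0 m1 m2 sg r a0 a1 a2 w : nat) :
  m0 + m1 + m2 + 1 = 2 * sg ->
  sg <= m0 + m1 -> sg <= m0 + m2 -> sg <= m1 + m2 ->
  let D := a0 + a1 + a2 + w in
  a0 + r.+1 * m0 <= D -> a1 + r.+1 * m1 <= D -> a2 + r.+1 * m2 <= D ->
  r.+1 * sg <= D + w ->
  exists b0 b1 b2 v, [/\ b0 <= a0, b1 <= a1, b2 <= a2, v <= w &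
   let d := b0 + b1 + b2 + v in
   [/\ b0 + m0 <= d, b1 + m1 <= d & b2 + m2 <= d] /\
   [/\ (a0 - b0) + r * m0 <= D - d, (a1 - b1) + r * m1 <= D - d,
    (a2 - b2) + r * m2 <= D - d & r * sg <= (D - d) + (w - v)]].
Proof.
move=> hs h01 h02 h12 D.
rewrite !mulSn => c0 c1 c2 c3.
set d := D %/ r.+1.
have [dlo dhi] : d + r * d <= D /\ D <= r * d + d + r.
  have := divn_eq D r.+1; have := ltn_pmod D (ltn0Sn r); rewrite -/d mulnS mulnC.
  by split; lia.
have e : r * m0 + r * m1 + r * m2 + r = 2 * (r * sg).
  by rewrite mulnCA -hs !mulnDr muln1.
have mono x y : x <= y -> r * x <= r * y by move=> xy; rewrite leq_mul2l xy orbT.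
have kP m' : m' + r * m' <= D -> m' <= d /\ r * m' <= r * d.
  move=> h; suff h' : m' <= d by split=> //; exact: mono.
  by rewrite leq_divRL // mulnC mulSn.
have k0 : m0 <= d /\ r * m0 <= r * d by apply: kP; lia.
have k1 : m1 <= d /\ r * m1 <= r * d by apply: kP; lia.
have k2 : m2 <= d /\ r * m2 <= r * d by apply: kP; lia.
have jP x y : x + y <= d /\ r * x + r * y <= r * d \/
    d < x + y /\ r * d + r <= r * x + r * y.
  by rewrite -mulnDr; exact: leq_mul_cases.
have j01 := jP m0 m1; have j02 := jP m0 m2; have j12 := jP m1 m2.
(* The borderline value d + 1 is kept apart: there the multiple of [sg] is known exactly, beyond it
   the gap is at least 2r. *)
have ksg : [\/ sg <= d /\ r * sg <= r * d, sg = d.+1 /\ r * sg = r * d + r |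
   d + 2 <= sg /\ r * d + 2 * r <= r * sg].
  case: (leq_mul_cases r sg d) => [h|[h _]]; first by constructor 1.
  case: (leqP sg d.+1) => h'; [constructor 2|constructor 3; split; first by lia].
    have -> : sg = d.+1 by lia.
    by rewrite mulnS addnC.
  by have := mono d.+2 sg h'; rewrite !mulnS; lia.
have i01 := mono _ _ h01; have i02 := mono _ _ h02; have i12 := mono _ _ h12.
rewrite !mulnDr in i01 i02 i12.
clear mono kP jP.
(* The remaining case analysis is linear once the products with r are atoms. *)
move: {hs}(r * m0) (r * m1) (r * m2) (r * d) (r * sg)
  hs e c0 c1 c2 c3 dlo dhi k0 k1 k2 j01 j02 j12 ksg i01 i02 i12; clearbody d.
move=> R0 R1 R2 Rd Rs hs e c0 c1 c2 c3 dlo dhi k0 k1 k2 j01 j02 j12 ksg i01 i02 i12.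
(* With d fixed, the requirements on the two parts are bounds on the single
   entries together with the value of their sum. *)
have [|||||x0 [x1 [x2 [x3 [y0 y1 y2 y3 y]]]]] := @box_sum4
  (d + a0 + R0 - D) (d + a1 + R1 - D) (d + a2 + R2 - D) 0
  (minn a0 (d - m0)) (minn a1 (d - m1)) (minn a2 (d - m2)) (minn w (D + w - d - Rs)) d.
1-3: rewrite /D in c0 c1 c2 c3 dlo dhi *; clear -c0 c1 c2 dlo dhi k0 k1 k2; lia.
- by [].
- rewrite /D in c0 c1 c2 c3 dlo dhi *; apply/andP; split.
  case: j01 => j01; case: j02 => j02; case: j12 => j12; case: ksg=> ksg; lia.
  (* The upper endpoints must sum to at least d. The differences inside the minima are exact, so
     they become unknowns [q0], ..., [q3], and each minimum is resolved by cases. *)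
  have n0 := subnKC (proj1 k0); have n1 := subnKC (proj1 k1); have n2 := subnKC (proj1 k2).
  move: (d - m0) (d - m1) (d - m2) n0 n1 n2 => q0 q1 q2 n0 n1 n2.
  have nv : d + Rs + (a0 + a1 + a2 + w + w - d - Rs) = a0 + a1 + a2 + w + w.
    by case: ksg; lia.
  move: (_ - d - Rs) nv => q3 nv.
  case: (leqP a0 q0) => g0; case: (leqP a1 q1) => g1;
   case: (leqP a2 q2) => g2; case: (leqP w q3) => g3; try lia;
   case: ksg=> -[s1 s2]; try lia;
   case: j01 => -[s3 s4]; try lia;
   case: j02 => -[s5 s6]; try lia;
   case: j12 => -[s7 s8]; lia.
exists x0, x1, x2, x3.
rewrite /D in c0 c1 c2 c3 dlo dhi y0 y1 y2 y3 *.
have nv : d + Rs <= a0 + a1 + a2 + w + w by clear -c3 dlo ksg; case: ksg; lia.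
clear -y0 y1 y2 y3 y k0 k1 k2 dlo nv.
case/andP: y0 => y0 /[!leq_min] /andP[y0a y0d].
case/andP: y1 => y1 /[!leq_min] /andP[y1a y1d].
case/andP: y2 => y2 /[!leq_min] /andP[y2a y2d].
move: y3 => /= /[!leq_min] /andP[y3w y3d].
case: k0 k1 k2 => [k0 _] [k1 _] [k2 _].
rewrite /= y {y}; split=> //; split; split.
- by clear -y0d k0; lia.
- by clear -y1d k1; lia.
- by clear -y2d k2; lia.
- by clear -y0 y0a dlo; lia.
- by clear -y1 y1a dlo; lia.
- by clear -y2 y2a dlo; lia.
- by clear -y3d y3w nv dlo; lia.
Qed.


Local Open Scope classical_set_scope.
Local Open Scope ring_scope.

(** * Ideals and their powers *)

Definition is_ideal (A : comNzRingType) (J : set A) : Prop :=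
  [/\ J 0, forall f g, J f -> J g -> J (f + g) & forall a f, J f -> J (a * f)].

Lemma is_ideal_sum (A : comNzRingType) (J : set A) (I : Type) (s : seq I)
    (P : pred I) (F : I -> A) :
  is_ideal J -> (forall i, P i -> J (F i)) -> J (\sum_(i <- s | P i) F i).
Proof. by move=> [J0 JD _] JF; elim/big_rec: _ => // i f Pi; apply: JD; exact: JF. Qed.

Lemma is_ideal_gen (A : comNzRingType) (S : set A) : is_ideal (ideal_gen S).
Proof.
split=> [|f g [k [c [u [Su ->]]]] [l [d [v [Sv ->]]]]|a f [k [c [u [Su ->]]]]].
- by exists 0, (fun=> 0), (fun=> 0); split=> [[]//|]; rewrite big_ord0.
- exists (k + l)%N, (fun i => match split i with inl j => c j | inr j => d j end),
    (fun i => match split i with inl j => u j | inr j => v j end).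
  split=> [i|]; first by case: (split i).
  rewrite big_split_ord /=; congr (_ + _); apply: eq_bigr => i _.
    by rewrite (unsplitK (inl _ i)).
  by rewrite (unsplitK (inr _ i)).
- exists k, (fun i => a * c i), u; split=> //.
  by rewrite mulr_sumr; apply: eq_bigr => i _; rewrite mulrA.
Qed.

Lemma sub_ideal_gen (A : comNzRingType) (S : set A) : S `<=` ideal_gen S.
Proof.
by move=> f Sf; exists 1%N, (fun=> 1), (fun=> f); split=> //; rewrite big_ord1 mul1r.
Qed.

Lemma ideal_gen_min (A : comNzRingType) (S J : set A) :
  is_ideal J -> S `<=` J -> ideal_gen S `<=` J.
Proof.
move=> Jid SJ _ [k [c [u [Su ->]]]]; apply: is_ideal_sum => // i _.
by have [_ _] := Jid; apply; exact/SJ/Su.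
Qed.

Lemma is_ideal_exp (A : comNzRingType) (I : set A) (r : nat) :
  is_ideal (ideal_exp I r).
Proof. by case: r => [|r]; [split | exact: is_ideal_gen]. Qed.

Lemma ideal_expS (A : comNzRingType) (I : set A) (r : nat) (f g : A) :
  I f -> ideal_exp I r g -> ideal_exp I r.+1 (f * g).
Proof. by move=> If Ig; apply: sub_ideal_gen; exists f, g. Qed.

(** Induction principle for powers: to bound every I^r from above, it suffices to exhibit a
    filtration by ideals that multiplication by I moves up one step. *)
Lemma ideal_exp_min (A : comNzRingType) (I : set A) (J : nat -> set A) :
  (forall r, is_ideal (J r)) -> J 0%N = setT ->
  (forall r f g, I f -> J r g -> J r.+1 (f * g)) ->
  forall r, ideal_exp I r `<=` J r.
Proof.
move=> Jid J0 JS; elim=> [|r IH]; first by rewrite J0.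
by apply: ideal_gen_min => // _ [f [g [If Ig ->]]]; apply: JS => //; exact: IH.
Qed.

(** * Monomial ideals and linear substitutions *)

Definition supp_in (K : fieldType) (n : nat) (T : set 'X_{1..n}) :
    set {mpoly K[n]} :=
  [set f | forall m, m \in msupp f -> T m].

Lemma supp_inM (K : fieldType) (n : nat) (T1 T2 T3 : set 'X_{1..n})
    (f g : {mpoly K[n]}) :
  (forall m1 m2, T1 m1 -> T2 m2 -> T3 (m1 + m2)%MM) ->
  supp_in T1 f -> supp_in T2 g -> supp_in T3 (f * g).
Proof.
move=> T123 Tf Tg m /msuppM_le /allpairsP [[m1 m2] /= [h1 h2 ->]].
by apply: T123; [exact: Tf | exact: Tg].
Qed.

(** For such an upward closed [T], [supp_in T] is the monomial ideal spanned by the x^m with m in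
    [T]. *)
Lemma is_ideal_supp_in (K : fieldType) (n : nat) (T : set 'X_{1..n}) :
  (forall m1 m2, T m2 -> T (m1 + m2)%MM) -> is_ideal (@supp_in K n T).
Proof.
move=> Tup; split=> [m|f g Tf Tg m|a f].
- by rewrite msupp0.
- by move/msuppD_le; rewrite mem_cat => /orP[]; [exact: Tf | exact: Tg].
- by apply: (@supp_inM _ _ setT) => // m1 m2 _; exact: Tup.
Qed.

(** Substitution along [lin_sub V] sends f(x) to f(xV) for row vectors x, so the i-th coordinate
    point takes the role of row i of [V]. *)
Definition lin_sub (K : fieldType) (n : nat) (V : 'M[K]_n) :
    n.-tuple {mpoly K[n]} :=
  [tuple \sum_k V k j *: 'X_k | j < n].

Lemma lin_subX (K : fieldType) (n : nat) (V : 'M[K]_n) (j : 'I_n) :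
  'X_j \mPo lin_sub V = \sum_k V k j *: 'X_k.
Proof. by rewrite comp_mpolyXU -tnth_nth tnth_mktuple. Qed.

Lemma rmorph_mpoly_id (K : fieldType) (n : nat) (h : {rmorphism {mpoly K[n]} -> {mpoly K[n]}}) :
  (forall c, h c%:MP = c%:MP) -> (forall j, h 'X_j = 'X_j) -> h =1 id.
Proof.
move=> hC hX p; rewrite {1}[p]mpolyE rmorph_sum /= [RHS]mpolyE.
apply: eq_bigr => m _; rewrite -!mul_mpolyC rmorphM /= hC; congr (_ * _).
rewrite mpolyXE_id rmorph_prod /=; apply: eq_bigr => i _.
by rewrite rmorphXn /= hX.
Qed.

Lemma lin_subK (K : fieldType) (n : nat) (V W : 'M[K]_n) :
  W *m V = 1%:M -> cancel (comp_mpoly (lin_sub V)) (comp_mpoly (lin_sub W)).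
Proof.
move=> WV p.
apply: (@rmorph_mpoly_id _ _ (comp_mpoly (lin_sub W) \o comp_mpoly (lin_sub V))) => [c|j] /=.
  by rewrite !comp_mpolyC.
rewrite lin_subX raddf_sum /=.
under eq_bigr do rewrite comp_mpolyZ lin_subX scaler_sumr.
rewrite exchange_big /=.
transitivity (\sum_(l < n) (l == j)%:R *: ('X_l : {mpoly K[n]})).
  apply: eq_bigr => l _; rewrite -(_ : (W *m V) l j = (l == j)%:R); last by rewrite WV mxE.
  by rewrite mxE scaler_suml; apply: eq_bigr => k _; rewrite scalerA mulrC.
rewrite (bigD1 j) //= eqxx scale1r big1 ?addr0 // => l /negPf ->.
by rewrite scale0r.
Qed.

Lemma dhomog_lin_sub (K : fieldType) (n : nat) (V : 'M[K]_n) (d : nat)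
    (f : {mpoly K[n]}) :
  f \is d.-homog -> f \mPo lin_sub V \is d.-homog.
Proof.
move=> /dhomogP fd; rewrite comp_mpolyEX big_seq; apply: rpred_sum => m mf.
have <- : mdeg m = d := fd m mf.
apply: rpredZ; rewrite comp_mpolyX mdegE.
elim/big_rec2: _ => [|i e p _ IH]; first exact: dhomog1.
apply: dhomogM => //; rewrite -{2}[m i]mul1n; apply: dhomogMn.
rewrite tnth_mktuple; apply: rpred_sum => k _; apply: rpredZ.
by rewrite dhomogX; apply/eqP/mdeg1.
Qed.

Lemma meval_lin_sub (K : fieldType) (n : nat) (V : 'M[K]_n) (i : 'I_n)
    (f : {mpoly K[n]}) :
  (f \mPo lin_sub V).@[fun k => (k == i)%:R] = f.@[V i].
Proof.
rewrite comp_mpoly_meval; apply: meval_eq => j.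
rewrite tnth_mktuple raddf_sum /= (bigD1 i) //= mevalZ mevalXU eqxx mulr1.
by rewrite big1 ?addr0 // => k /negPf ki; rewrite mevalZ mevalXU ki mulr0.
Qed.

(** * Powers of a point ideal as monomial ideals *)

(** Exponents of the k-th power of the ideal of the i-th coordinate point: degree at least k in the
    variables other than x_i, phrased without truncated subtraction. *)
Definition off_deg_ge (n : nat) (i : 'I_n) (k : nat) : set 'X_{1..n} :=
  [set m : 'X_{1..n} | (k + m i <= mdeg m)%N].

(** The value of a form of degree d at the i-th coordinate point is its coefficient at x_i^d, and
    every other monomial of degree d involves another variable. *)
Lemma dhomog_vanish (K : fieldType) (n : nat) (i : 'I_n) (d : nat)
    (f : {mpoly K[n]}) :
  f \is d.-homog -> f.@[fun k => (k == i)%:R] = 0 -> supp_in (off_deg_ge i 1) f.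
Proof.
move=> /dhomogP fd f0 m mf; rewrite /off_deg_ge /= add1n ltnNge; apply/negP => mi.
have degd m' : m' \in msupp f -> mdeg m' = d := fd m'.
have offi (m' : 'X_{1..n}) k : k != i -> (m' i + m' k <= mdeg m')%N.
  by move=> ki; rewrite mdegE (bigD1 i) //= (bigD1 k) //= addnA leq_addr.
have onlyi m' : m' \in msupp f -> m' != m -> exists2 k, k != i & m' k != 0%N.
  move=> m'f /eqP mm'; have [/existsP[k /andP[ki mk]]|/existsPn h] :=
    boolP [exists k, (k != i) && (m' k != 0%N)]; first by exists k.
  case: mm'; apply/mnmP.
  have h0 k : k != i -> m' k = 0%N by move=> ki; have := h k; rewrite ki /= negbK => /eqP.
  have h1 k : k != i -> m k = 0%N by move/(offi m); lia.
  have e : m' i = m i.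
    move: (degd _ m'f) (degd _ mf); rewrite !mdegE.
    by rewrite (bigD1 i) //= [X in _ -> X = _ -> _](bigD1 i) //= !big1 ?addn0 // => <- .
  by move=> k; case: (eqVneq k i) => [->//|ki]; rewrite h0 ?h1.
move: f0; rewrite mevalE (bigD1_seq m) ?msupp_uniq //= [X in _ + X]big1_seq => [|m' /andP[m'm m'f]].
  rewrite big1 => [|k _]; last first.
    have [->|ki] := eqVneq k i; first by rewrite expr1n.
    suff -> : m k = 0%N by rewrite expr0.
    by move/(offi m): ki; lia.
  by rewrite addr0 mulr1 => /eqP; rewrite mcoeff_eq0 mf.
have [k ki mk] := onlyi _ m'f m'm.
by rewrite (bigD1 k) //= (negPf ki) expr0n (negPf mk) mul0r mulr0.
Qed.

Lemma point_ideal_exp_supp (K : fieldType) (N : nat) (P : ppoint K N)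
    (V : 'M[K]_N.+1) (i : 'I_N.+1) (k : nat) (f : {mpoly K[N.+1]}) :
  row i V = val P -> ideal_exp (point_ideal P) k f ->
  supp_in (off_deg_ge i k) (f \mPo lin_sub V).
Proof.
move=> VP.
have up j : is_ideal (@supp_in K _ (off_deg_ge i j)).
  apply: is_ideal_supp_in => m1 m2; rewrite /off_deg_ge /= mdegD mnmDE => h.
  by rewrite addnCA leq_add // mdegE (bigD1 i) //= leq_addr.
have pull j : is_ideal [set g | supp_in (off_deg_ge i j) (g \mPo lin_sub V)].
  have [J0 JD JM] := up j; split=> [|g h Jg Jh|a g Jg] /=.
  - by rewrite comp_mpoly0.
  - by rewrite comp_mpolyD; exact: JD.
  - by rewrite (rmorphM (comp_mpoly (lin_sub V))); exact: JM.
move: k f; apply: (ideal_exp_min pull).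
  by apply/seteqP; split=> // g _ m _; rewrite /off_deg_ge /= mdegE (bigD1 i) //= leq_addr.
move=> r f g Pf Jg; rewrite /= (rmorphM (comp_mpoly (lin_sub V))) /=.
have : supp_in (off_deg_ge i 1) (f \mPo lin_sub V).
  move: f Pf {g Jg}; apply: (ideal_gen_min (pull 1%N)) => f [[d fd] f0] /=.
  apply: dhomog_vanish (dhomog_lin_sub V fd) _.
  rewrite meval_lin_sub -[RHS]f0; apply: meval_eq => j.
  by rewrite -VP mxE.
move=> Jf; apply: (supp_inM _ Jf Jg) => m1 m2.
by rewrite /off_deg_ge /= mdegD mnmDE; lia.
Qed.


(** Peel off k variables x_j with j distinct from i. Each becomes a linear form whose value at P is
    the (i, j) entry of [V *m W], hence 0. *)
Lemma point_ideal_exp_mono (K : fieldType) (N : nat) (P : ppoint K N)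
    (V W : 'M[K]_N.+1) (i : 'I_N.+1) (k : nat) (m : 'X_{1..N.+1}) :
  V *m W = 1%:M -> row i V = val P -> off_deg_ge i k m ->
  ideal_exp (point_ideal P) k ('X_[m] \mPo lin_sub W).
Proof.
move=> VW VP; elim: k m => [//|k IH] m mk.
have [j ji mj] : exists2 j, j != i & (0 < m j)%N.
  have [/existsP[j /andP[ji mj]]|/existsPn h] :=
    boolP [exists j, (j != i) && (0 < m j)%N]; first by exists j.
  move: mk; rewrite /off_deg_ge /= mdegE (bigD1 i) //= big1 ?addn0; first by lia.
  by move=> j ji; have := h j; rewrite ji /= -eqn0Ngt => /eqP.
have Um : (U_(j) <= m)%MM.
  by apply/mnm_lepP => l; rewrite mnm1E; case: eqVneq => // <-.
rewrite -(submK Um) addmC mpolyXD (rmorphM (comp_mpoly (lin_sub W))) /=; apply: ideal_expS; last first.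
  apply: IH; move: mk; rewrite /off_deg_ge /= -{1 2}(submK Um) mdegD mnmDE mdeg1 mnm1E (negPf ji).
  by lia.
apply: sub_ideal_gen; split.
  by exists 1%N; apply: dhomog_lin_sub; rewrite dhomogX; apply/eqP/mdeg1.
have <- : (V *m W) i j = 0 by rewrite VW mxE eq_sym (negPf ji).
rewrite [RHS]mxE lin_subX raddf_sum; apply: eq_bigr => l _ /=.
by rewrite mevalZ mevalXU mulrC -VP mxE.
Qed.

(** * Symbolic powers in adapted coordinates *)

Lemma fat_ideal_symbolic (K : fieldType) (N : nat) (Z : fat_points K N) :
  fat_ideal Z = symbolic_power Z 1.
Proof.
by apply/seteqP; split=> f Zf pm /Zf; rewrite mul1n.
Qed.

Definition fat_exponents (n : nat) (i0 i1 i2 : 'I_n) (m0 m1 m2 k : nat) :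
    set 'X_{1..n} :=
  [set m | [/\ off_deg_ge i0 (k * m0) m, off_deg_ge i1 (k * m1) m
    & off_deg_ge i2 (k * m2) m]].

Lemma symbolic_power_supp (K : fieldType) (N : nat) (P0 P1 P2 : ppoint K N)
    (m0 m1 m2 k : nat) (V : 'M[K]_N.+1) (i0 i1 i2 : 'I_N.+1) (f : {mpoly K[N.+1]}) :
  row i0 V = val P0 -> row i1 V = val P1 -> row i2 V = val P2 ->
  symbolic_power [:: (P0, m0); (P1, m1); (P2, m2)] k f ->
  supp_in (fat_exponents i0 i1 i2 m0 m1 m2 k) (f \mPo lin_sub V).
Proof.
move=> V0 V1 V2 Zf m mf; split.
- have /= h := Zf (P0, m0); apply: (point_ideal_exp_supp V0 (h _)) => //.
  by rewrite !inE eqxx.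
- have /= h := Zf (P1, m1); apply: (point_ideal_exp_supp V1 (h _)) => //.
  by rewrite !inE eqxx orbT.
- have /= h := Zf (P2, m2); apply: (point_ideal_exp_supp V2 (h _)) => //.
  by rewrite !inE eqxx !orbT.
Qed.

(** With [symbolic_power_supp], this identifies the symbolic power with a monomial ideal in the new
    coordinates. *)
Lemma symbolic_power_mono (K : fieldType) (N : nat) (P0 P1 P2 : ppoint K N)
    (m0 m1 m2 k : nat) (V W : 'M[K]_N.+1) (i0 i1 i2 : 'I_N.+1) (m : 'X_{1..N.+1}) :
  V *m W = 1%:M ->
  row i0 V = val P0 -> row i1 V = val P1 -> row i2 V = val P2 ->
  fat_exponents i0 i1 i2 m0 m1 m2 k m ->
  symbolic_power [:: (P0, m0); (P1, m1); (P2, m2)] k ('X_[m] \mPo lin_sub W).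
Proof.
move=> VW V0 V1 V2 [h0 h1 h2] pm; rewrite !inE => /or3P[] /eqP -> /=.
- exact: point_ideal_exp_mono VW V0 h0.
- exact: point_ideal_exp_mono VW V1 h1.
- exact: point_ideal_exp_mono VW V2 h2.
Qed.

(** * Coordinates adapted to three noncollinear points *)

(** Needed because [collinear] asks for dimension exactly 2, while dependent vectors may span
    less. *)
Lemma dimv_extend (K : fieldType) (vT : vectType K) (U : {vspace vT}) (k : nat) :
  (\dim U <= k)%N -> (k <= \dim {:vT})%N ->
  exists2 L : {vspace vT}, (U <= L)%VS & \dim L = k.
Proof.
elim: k => [|k IH]; first by rewrite leqn0 => /eqP; exists U.
rewrite leq_eqVlt => /orP[/eqP Uk _|Uk kT]; first by exists U.
have [L UL Lk] := IH Uk (ltnW kT).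
have [v vL] : exists v, v \notin L.
  exists (vpick L^C); apply: contraL kT => vL; rewrite -leqNgt -Lk.
  have : vpick L^C%VS \in (L :&: L^C)%VS by rewrite memv_cap vL memv_pick.
  rewrite capv_compl memv0 vpick0 => /eqP LC.
  by rewrite -(addv_complf L) LC addv0.
exists (L + <[v]>)%VS; first exact: subv_trans UL (addvSl _ _).
rewrite dimv_disjoint_sum ?dim_vline.
  by rewrite Lk; case: eqP vL => [->|_]; rewrite ?mem0v ?addn1.
apply/eqP; rewrite -subv0; apply/subvP => u; rewrite memv_cap => /andP[uL /vlineP[c uc]].
move: uL; rewrite uc memv0; have [->|c0] := eqVneq c 0; first by rewrite scale0r.
by move/(memvZ c^-1); rewrite scalerA mulVf // scale1r (negPf vL).
Qed.

Lemma noncollinear_frame (K : fieldType) (N : nat) (P0 P1 P2 : ppoint K N) :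
  (2 <= N)%N -> ~ collinear P0 P1 P2 ->
  exists V : 'M[K]_N.+1, [/\ V \in unitmx, row (inord 0) V = val P0,
    row (inord 1) V = val P1 & row (inord 2) V = val P2].
Proof.
move=> hN ncol; pose X := [:: val P0; val P1; val P2].
have fX : free X.
  apply: contra_notT ncol => nfX.
  have dX : (\dim <<X>> <= 2)%N.
    by have := dim_span X; rewrite leq_eqVlt -[_ == _]/(free X) (negPf nfX).
  have [|L XL dL] := dimv_extend dX; first by rewrite dimvf /dim /= mul1n; lia.
  exists L; split=> //; apply: (subvP XL); apply: memv_span; by rewrite !inE eqxx ?orbT.
pose A : 'M[K]_(3, N.+1) := \matrix_(i < 3) X`_i.
have rA : row_free A.
  apply: inj_row_free => u uA.
  have /freeP h : free (in_tuple X) by [].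
  apply/rowP => i; rewrite mxE; apply: (h (u 0)).
  rewrite -[RHS]uA mulmx_sum_row; apply: eq_bigr => j _.
  by rewrite rowK.
(* [U] selects the first three rows. Padding [A] with zero rows gives a square matrix of full rank
   on the row space of [U], so some invertible [V] agrees with it there. *)
pose U : 'M[K]_(3, N.+1) := pid_mx 3.
have UA : U *m ((pid_mx 3 : 'M_(N.+1, 3)) *m A) = A.
  by rewrite mulmxA pid_mx_id // pid_mx_1 mul1mx.
have [|V Vu UV] := @complete_unitmx _ _ _ U ((pid_mx 3 : 'M_(N.+1, 3)) *m A).
  by rewrite UA rank_pid_mx //; exact/eqP.
have rV (i : 'I_3) : row (inord i) V = X`_i.
  rewrite -(rowK (fun i : 'I_3 => X`_i) i) -/A -UA UV row_mul [LHS]rowE; congr (_ *m _).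
  apply/rowP => j; rewrite !mxE eqxx /= -val_eqE /= inordK; last by have := ltn_ord i; lia.
  by rewrite eq_sym ltn_ord andbT.
exists V; split=> //.
- exact: (rV (@Ordinal 3 0 isT)).
- exact: (rV (@Ordinal 3 1 isT)).
- exact: (rV (@Ordinal 3 2 isT)).
Qed.

(** * Ordinary powers of the fat point ideal *)

Definition rest_deg (n : nat) (i0 i1 i2 : 'I_n) (m : 'X_{1..n}) : nat :=
  (\sum_(j | [&& j != i0, j != i1 & j != i2]) m j)%N.

Lemma mdeg_rest (n : nat) (i0 i1 i2 : 'I_n) (m : 'X_{1..n}) :
  uniq [:: i0; i1; i2] ->
  mdeg m = (m i0 + m i1 + m i2 + rest_deg i0 i1 i2 m)%N.
Proof.
rewrite /= !inE negb_or andbT => /andP[/andP[i01 i02] i12].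
rewrite mdegE (bigD1 i0) //= (bigD1 i1) /=; last by rewrite eq_sym.
rewrite (bigD1 i2) /=; last by rewrite ![i2 == _]eq_sym i02.
by rewrite !addnA; congr addn; apply: eq_bigl => j; rewrite andbA.
Qed.

(** Distributes the degree [v] obtained from [weight_peel] over the individual variables vanishing
    at all three points. *)
Lemma split_sum (I : finType) (P : pred I) (f : I -> nat) (v : nat) :
  (v <= \sum_(i | P i) f i)%N ->
  exists2 g : I -> nat, forall i, (g i <= f i)%N & (\sum_(i | P i) g i = v)%N.
Proof.
elim: v => [|v IH] vf; first by exists (fun=> 0%N) => //; rewrite big1.
have [g gf gv] := IH (ltnW vf).
have [/existsP[i /andP[Pi gi]]|/existsPn h] :=
    boolP [exists i, P i && (g i < f i)%N]; last first.
  move: vf; rewrite -gv ltnNge leq_sum // => i Pi.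
  by have := h i; rewrite Pi /= -leqNgt.
exists (fun j => g j + (j == i))%N => [j|].
  by case: eqP => [->|_]; rewrite ?addn1 ?addn0.
rewrite big_split /= gv (bigD1 i) //= eqxx big1 ?addn0 ?addn1 // => j /andP[_ /negPf -> //].
Qed.

(** Monomials with these exponents lie in I^r by [rounded_mono_exp]; the last inequality is
    necessary by [ideal_exp_supp]. *)
Definition rounded_exponents (n : nat) (i0 i1 i2 : 'I_n) (m0 m1 m2 sg r : nat) :
    set 'X_{1..n} :=
  [set m | fat_exponents i0 i1 i2 m0 m1 m2 r m /\
     (r * sg <= mdeg m + rest_deg i0 i1 i2 m)%N].

Lemma rounded_peel (n : nat) (i0 i1 i2 : 'I_n) (m0 m1 m2 sg r : nat)
    (m : 'X_{1..n}) :
  uniq [:: i0; i1; i2] -> (m0 + m1 + m2 + 1 = 2 * sg)%N ->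
  (sg <= m0 + m1)%N -> (sg <= m0 + m2)%N -> (sg <= m1 + m2)%N ->
  rounded_exponents i0 i1 i2 m0 m1 m2 sg r.+1 m ->
  exists b c, [/\ m = (b + c)%MM, fat_exponents i0 i1 i2 m0 m1 m2 1 b
    & rounded_exponents i0 i1 i2 m0 m1 m2 sg r c].
Proof.
move=> iu hs h01 h02 h12; have md := fun m => mdeg_rest m iu.
rewrite /rounded_exponents /fat_exponents /off_deg_ge /= !md.
move=> -[[c0 c1 c2] c3]; rewrite addnC in c0; rewrite addnC in c1; rewrite addnC in c2.
have [b0 [b1 [b2 [v [e0 e1 e2 ev /= [f g]]]]]] := weight_peel hs h01 h02 h12 c0 c1 c2 c3.
have [u um uv] := split_sum ev.
pose b := [multinom if j == i0 then b0 else if j == i1 then b1 else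
  if j == i2 then b2 else u j | j < n].
have /= := iu; rewrite !inE negb_or andbT => /andP[/andP[i01 i02] i12].
have bi0 : b i0 = b0 by rewrite mnmE eqxx.
have bi1 : b i1 = b1 by rewrite mnmE eq_sym (negPf i01) eqxx.
have bi2 : b i2 = b2 by rewrite mnmE ![i2 == _]eq_sym (negPf i02) (negPf i12) eqxx.
have bw : rest_deg i0 i1 i2 b = v.
  rewrite -uv; apply: eq_bigr => j /and3P[/negPf j0 /negPf j1 /negPf j2].
  by rewrite mnmE j0 j1 j2.
have bm : (b <= m)%MM.
  apply/mnm_lepP => j; rewrite mnmE.
  by case: eqP => [->//|_]; case: eqP => [->//|_]; case: eqP => [->//|_].
have cm : m = (b + (m - b))%MM by rewrite addmC submK.
have cw : rest_deg i0 i1 i2 (m - b) = (rest_deg i0 i1 i2 m - v)%N.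
  rewrite [in RHS]cm -bw /rest_deg.
  by under [X in (X - _)%N]eq_bigr do rewrite mnmDE; rewrite big_split addKn.
exists b, (m - b)%MM; split=> //; rewrite !md ?bw ?cw ?mnmBE ?bi0 ?bi1 ?bi2.
  by rewrite !mul1n; case: f => *; split; lia.
case: g => g0 g1 g2 g3.
have -> : (m i0 - b0 + (m i1 - b1) + (m i2 - b2) + (rest_deg i0 i1 i2 m - v) =
  m i0 + m i1 + m i2 + rest_deg i0 i1 i2 m - (b0 + b1 + b2 + v))%N by lia.
by split=> //; split; rewrite addnC.
Qed.

Lemma rounded_mono_exp (K : fieldType) (N : nat) (P0 P1 P2 : ppoint K N)
    (m0 m1 m2 sg r : nat) (V W : 'M[K]_N.+1) (i0 i1 i2 : 'I_N.+1) (m : 'X_{1..N.+1}) :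
  V *m W = 1%:M ->
  row i0 V = val P0 -> row i1 V = val P1 -> row i2 V = val P2 ->
  uniq [:: i0; i1; i2] -> (m0 + m1 + m2 + 1 = 2 * sg)%N ->
  (sg <= m0 + m1)%N -> (sg <= m0 + m2)%N -> (sg <= m1 + m2)%N ->
  rounded_exponents i0 i1 i2 m0 m1 m2 sg r m ->
  ideal_exp (fat_ideal [:: (P0, m0); (P1, m1); (P2, m2)]) r ('X_[m] \mPo lin_sub W).
Proof.
move=> VW V0 V1 V2 iu hs h01 h02 h12; elim: r m => [//|r IH] m.
move/(rounded_peel iu hs h01 h02 h12) => [b [c [-> b1 cr]]].
rewrite mpolyXD (rmorphM (comp_mpoly (lin_sub W))) /=.
apply: ideal_expS; last exact: IH.
by rewrite fat_ideal_symbolic; exact: (symbolic_power_mono VW V0 V1 V2 b1).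
Qed.

(** Since s < 2 sg, the hypothesis forces r <= k, which gives the three point conditions. Adding
    those for k yields 2 r sg <= k s <= 2D + w <= 2(D + w). *)
Lemma fat_exponents_rounded (n : nat) (i0 i1 i2 : 'I_n) (m0 m1 m2 sg r k : nat)
    (m : 'X_{1..n}) :
  uniq [:: i0; i1; i2] -> (m0 + m1 + m2 + 1 = 2 * sg)%N ->
  (r * (2 * sg) <= k * (m0 + m1 + m2))%N ->
  fat_exponents i0 i1 i2 m0 m1 m2 k m ->
  rounded_exponents i0 i1 i2 m0 m1 m2 sg r m.
Proof.
move=> iu hs rk; rewrite /rounded_exponents /fat_exponents /off_deg_ge /=.
rewrite (mdeg_rest m iu) => -[c0 c1 c2].
have rlek : (r <= k)%N by nia.
have := leq_mul rlek (leqnn m0); have := leq_mul rlek (leqnn m1).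
have := leq_mul rlek (leqnn m2).
by move: rk; rewrite mulnCA !(mulnDr k); split; [split; lia|lia].
Qed.

Lemma symbolic_sub_exp (K : fieldType) (N : nat) (P0 P1 P2 : ppoint K N)
    (m0 m1 m2 sg r k : nat) (V : 'M[K]_N.+1) (i0 i1 i2 : 'I_N.+1) :
  V \in unitmx ->
  row i0 V = val P0 -> row i1 V = val P1 -> row i2 V = val P2 ->
  uniq [:: i0; i1; i2] -> (m0 + m1 + m2 + 1 = 2 * sg)%N ->
  (sg <= m0 + m1)%N -> (sg <= m0 + m2)%N -> (sg <= m1 + m2)%N ->
  (r * (2 * sg) <= k * (m0 + m1 + m2))%N ->
  let Z := [:: (P0, m0); (P1, m1); (P2, m2)] in
  symbolic_power Z k `<=` ideal_exp (fat_ideal Z) r.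
Proof.
move=> Vu V0 V1 V2 iu hs h01 h02 h12 rk Z f Zf.
have := symbolic_power_supp V0 V1 V2 Zf.
(* Write f as the transform of its expression g in the new coordinates; the monomials of g can then
   be treated one by one. *)
rewrite -[f in ideal_exp _ _ f](lin_subK (mulVmx Vu)).
move: (f \mPo lin_sub V) => g gT; rewrite [g]mpolyE raddf_sum /= big_seq.
have Iid := is_ideal_exp (fat_ideal Z) r.
apply: is_ideal_sum => // m mg; rewrite comp_mpolyZ -mul_mpolyC.
have [_ _ IM] := Iid; apply: IM.
apply: (rounded_mono_exp (mulmxV Vu) V0 V1 V2 iu hs h01 h02 h12).
exact: (fat_exponents_rounded iu hs rk (gT _ mg)).
Qed.

Lemma ideal_exp_supp (K : fieldType) (N : nat) (P0 P1 P2 : ppoint K N)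
    (m0 m1 m2 sg r : nat) (V : 'M[K]_N.+1) (i0 i1 i2 : 'I_N.+1) (f : {mpoly K[N.+1]}) :
  row i0 V = val P0 -> row i1 V = val P1 -> row i2 V = val P2 ->
  uniq [:: i0; i1; i2] -> (m0 + m1 + m2 + 1 = 2 * sg)%N ->
  ideal_exp (fat_ideal [:: (P0, m0); (P1, m1); (P2, m2)]) r f ->
  supp_in [set m | (r * sg <= mdeg m + rest_deg i0 i1 i2 m)%N] (f \mPo lin_sub V).
Proof.
move=> V0 V1 V2 iu hs.
have restD m m' : rest_deg i0 i1 i2 (m + m')%MM =
    (rest_deg i0 i1 i2 m + rest_deg i0 i1 i2 m')%N.
  by rewrite -big_split; apply: eq_bigr => j _; rewrite mnmDE.
pose T k : set 'X_{1..N.+1} := [set m | (k * sg <= mdeg m + rest_deg i0 i1 i2 m)%N].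
have pull k : is_ideal [set g | supp_in (T k) (g \mPo lin_sub V)].
  have [|J0 JD JM] := @is_ideal_supp_in K _ (T k).
    by move=> m m'; rewrite /T /= mdegD restD; lia.
  split=> [|g h Jg Jh|a g Jg] /=.
  - by rewrite comp_mpoly0.
  - by rewrite comp_mpolyD; exact: JD.
  - by rewrite (rmorphM (comp_mpoly (lin_sub V))); exact: JM.
move: r f; apply: (ideal_exp_min pull).
  by apply/seteqP; split=> // g _ m _; rewrite /T /= mul0n.
move=> r f g; rewrite fat_ideal_symbolic => Zf Jg.
rewrite /= (rmorphM (comp_mpoly (lin_sub V))) /=.
apply: (supp_inM _ (symbolic_power_supp V0 V1 V2 Zf) Jg) => m m' [].
rewrite /T /off_deg_ge /= mdegD restD !mul1n mulSn => c0 c1 c2.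
(* The weight D + w is additive, so one factor in I is enough. There the three conditions add up to
   2 sg - 1 <= 2D + w <= 2(D + w), and parity rounds this up. *)
suff : (sg <= mdeg m + rest_deg i0 i1 i2 m)%N by lia.
by move: c0 c1 c2; rewrite (mdeg_rest m iu); lia.
Qed.

Lemma symbolic_not_sub_exp (K : fieldType) (N : nat) (P0 P1 P2 : ppoint K N)
    (m0 m1 m2 sg r t : nat) (V : 'M[K]_N.+1) (i0 i1 i2 : 'I_N.+1) :
  V \in unitmx ->
  row i0 V = val P0 -> row i1 V = val P1 -> row i2 V = val P2 ->
  uniq [:: i0; i1; i2] -> (m0 + m1 + m2 + 1 = 2 * sg)%N ->
  (sg <= m0 + m1)%N -> (sg <= m0 + m2)%N -> (sg <= m1 + m2)%N ->
  (t * (m0 + m1 + m2) < r * sg)%N ->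
  let Z := [:: (P0, m0); (P1, m1); (P2, m2)] in
  ~ (symbolic_power Z (2 * t) `<=` ideal_exp (fat_ideal Z) r).
Proof.
move=> Vu V0 V1 V2 iu hs h01 h02 h12 tr Z sub.
(* This choice makes all three conditions for I^(2t) equalities and has w = 0, so D + w is only t s.
   The subtractions are exact because every m_i is less than [sg]. *)
pose m := [multinom if j == i0 then (t * (m1 + m2 - m0))%N else
  if j == i1 then (t * (m0 + m2 - m1))%N else
  if j == i2 then (t * (m0 + m1 - m2))%N else 0%N | j < N.+1].
have /= := iu; rewrite !inE negb_or andbT => /andP[/andP[i01 i02] i12].
have mi0 : m i0 = (t * (m1 + m2 - m0))%N by rewrite mnmE eqxx.
have mi1 : m i1 = (t * (m0 + m2 - m1))%N by rewrite mnmE eq_sym (negPf i01) eqxx.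
have mi2 : m i2 = (t * (m0 + m1 - m2))%N.
  by rewrite mnmE ![i2 == _]eq_sym (negPf i02) (negPf i12) eqxx.
have mw : rest_deg i0 i1 i2 m = 0%N.
  rewrite /rest_deg big1 // => j /and3P[/negPf j0 /negPf j1 /negPf j2].
  by rewrite mnmE j0 j1 j2.
have md : mdeg m = (t * (m0 + m1 + m2))%N.
  by rewrite (mdeg_rest m iu) mi0 mi1 mi2 mw addn0 -!mulnDr; congr muln; lia.
have mT : fat_exponents i0 i1 i2 m0 m1 m2 (2 * t) m.
  by split; rewrite /off_deg_ge /= md ?mi0 ?mi1 ?mi2 (mulnC 2) -mulnA -mulnDr leq_mul2l;
    apply/orP; right; lia.
have := ideal_exp_supp V0 V1 V2 iu hs
  (sub _ (symbolic_power_mono (mulmxV Vu) V0 V1 V2 mT)).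
rewrite (lin_subK (mulmxV Vu)) => /(_ m).
rewrite msuppX inE eqxx => /(_ isT) /=.
by rewrite md mw addn0 leqNgt tr.
Qed.

(** * Computation of the supremum *)

Theorem theorem1p7 (R : realType) (K : closedFieldType) (N : nat)
    (hN : (2 <= N)%N) (P0 P1 P2 : ppoint K N)
    (hP : ~ collinear P0 P1 P2)
    (m0 m1 m2 : nat) (hmax : (maxn m0 m1 <= m2)%N)
    (hsum : (m2 < m0 + m1)%N) (hodd : odd (m0 + m1 + m2)) :
  resurgence R [:: (P0, m0); (P1, m1); (P2, m2)]
    = (m0 + m1 + m2 + 1)%:R / (m0 + m1 + m2)%:R.
Proof.
have [V [Vu V0 V1 V2]] := noncollinear_frame hN hP.
have iu : uniq [:: inord 0; inord 1; inord 2 : 'I_N.+1].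
  by rewrite /= !inE negb_or -!val_eqE /= !inordK //; lia.
pose s := (m0 + m1 + m2)%N; pose sg := (s.+1./2)%N.
have hs : (m0 + m1 + m2 + 1 = 2 * sg)%N.
  by rewrite /sg /s mul2n even_halfK ?addn1 //= hodd.
(* Each of these three bounds is a strict triangle inequality m_k < m_i + m_j, rewritten using s + 1
   = 2 sg. *)
have h01 : (sg <= m0 + m1)%N by lia.
have h02 : (sg <= m0 + m2)%N by lia.
have h12 : (sg <= m1 + m2)%N by lia.
have s_gt0 : (0 < s)%N by rewrite /s; lia.
rewrite hs -/s /resurgence; set S := [set q | _]; set c := _ / _.
have sR : 0 < s%:R :> R by rewrite ltr0n.
have ubS : ubound S c.
  move=> _ [m [r [m0' r0 nsub ->]]]; rewrite leNgt; apply/negP => h.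
  apply: nsub; apply: (symbolic_sub_exp Vu V0 V1 V2 iu hs h01 h02 h12).
  move: h; rewrite /c ltr_pdivrMr // mulrAC ltr_pdivlMr ?ltr0n // -!natrM ltr_nat.
  by rewrite mulnC; exact: ltnW.
(* With t = 2 sg (k+1), equality t s = r sg would occur at r = 2 s (k+1). Adding 1 to this r makes
   the inequality strict, and the ratios still tend to c. *)
have Sk (k : nat) : S ((2 * (2 * sg * k.+1))%:R / (2 * s * k.+1).+1%:R).
  exists (2 * (2 * sg * k.+1))%N, (2 * s * k.+1).+1; split=> //; first by lia.
  apply: (symbolic_not_sub_exp Vu V0 V1 V2 iu hs h01 h02 h12).
  by rewrite -/s; nia.
have supS : has_sup S by split; [eexists; exact: (Sk 0%N) | exists c].
apply/eqP; rewrite eq_le; apply/andP; split.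
  by apply: ge_sup => //; case: supS.
rewrite leNgt; apply/negP => lt_c; set e := c - sup S.
have e0 : 0 < e by rewrite subr_gt0.
(* For u = k + 1 the member [Sk k] equals c - c / (2 s u + 1). As s >= 1, u e > c makes it exceed c
   - e = sup S. *)
pose k := Num.truncn (c / e).
have ck : c < k.+1%:R * e by rewrite -ltr_pdivrMr // Num.Theory.truncnS_gt.
have := sup_upper_bound supS (Sk k); rewrite leNgt => /negP; apply.
rewrite ltr_pdivlMr ?ltr0n //.
have -> : sup S = c - e by rewrite /e opprB addrC subrK.
have cs : c * s%:R = (2 * sg)%:R by rewrite /c mulfVK // gt_eqF.
have s1 : 1 <= s%:R :> R by rewrite ler1n.
set u := k.+1%:R in ck *.
have -> : (2 * (2 * sg * k.+1))%:R = 2 * (c * s%:R * u) :> R.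
  by rewrite cs /u -!natrM.
rewrite -natr1 !natrM -/u.
have u0 : 0 <= u * e by rewrite mulr_ge0 ?ler0n ?ltW.
by nra.
Qed.
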